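(* Let $0<a<b<c$ be real numbers. Let $P_1=(j_1,k_1)$ and $P_2=(j_2,k_2)$ be points of $\mathbb{N}^2$ with $P_1\neq P_2$. (i) If $X,Y\sim \mathrm{Unif}\{a,b,c\}$ satisfy $\{P_1,P_2\}\subseteq \mathcal{U}(X,Y)$ and $j_1=j_2=j$, then $v_j:=\{(j,m):m\in\mathbb{N}\}\subseteq \mathcal{U}(X,Y)$. (ii) If $X,Y\sim \mathrm{Unif}\{a,b,c\}$ satisfy $\{P_1,P_2\}\subseteq \mathcal{U}(X,Y)$ and $k_1=k_2=k$, then $h_k:=\{(n,k):n\in\mathbb{N}\}\subseteq \mathcal{U}(X,Y)$. (iii) If $j_1\neq j_2$ and $k_1\neq k_2$, then there exist $X,Y\sim \mathrm{Unif}\{a,b,c\}$ such that $\mathcal{U}(X,Y)=\{P_1,P_2\}$.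
   Context: $\mathbb{N}=\{1,2,3,\dots\}$. For a random vector $(X,Y)$ whose components have finite moments of all orders, the uncorrelatedness set is $\mathcal{U}(X,Y)=\{(j,k)\in\mathbb{N}^2: \mathbf{E}[X^jY^k]=\mathbf{E}[X^j]\,\mathbf{E}[Y^k]\}$. $X\sim\mathrm{Unif}\{a,b,c\}$ means that $X$ takes each of the three values $a,b,c$ with probability $1/3$; ''$X,Y\sim \mathrm{Unif}\{a,b,c\}$'' means that $(X,Y)$ is a random vector (with an arbitrary joint distribution) both of whose marginals are $\mathrm{Unif}\{a,b,c\}$. *)

(* Defs.v *)
From HB Require Import structures.
From mathcomp Require Import all_boot all_order all_algebra.
From mathcomp Require Import all_classical all_reals all_analysis.
Set Implicit Arguments.
Unset Strict Implicit.
Unset Printing Implicit Defensive.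
Import Order.TTheory GRing.Theory Num.Theory.
Import numFieldNormedType.Exports.
Local Open Scope classical_set_scope.
Local Open Scope ring_scope.

(* Meant for pairwise distinct [a], [b], [c]; the three masses then add up
   to 1, so that [X] takes no other value almost surely. *)
Definition unif3 d (T : measurableType d) (R : realType) (P : probability T R)
    (a b c : R) (X : {RV P >-> R}) : Prop :=
  [/\ distribution P X [set a] = (3^-1)%:E,
      distribution P X [set b] = (3^-1)%:E &
      distribution P X [set c] = (3^-1)%:E].

(* The exponents range over the positive integers, represented as elements of
   [nat] subject to a positivity condition. The moments are extended reals;
   they are all finite for the bounded laws of interest. *)
Definition uncorrelatedness_set d (T : measurableType d) (R : realType)
    (P : probability T R) (X Y : {RV P >-> R}) : set (nat * nat) :=
  [set p | [/\ (0 < p.1)%N, (0 < p.2)%N & (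
    'E_P[(fun t => X t ^+ p.1 * Y t ^+ p.2)%R] =
    'E_P[(fun t => X t ^+ p.1)%R] * 'E_P[(fun t => Y t ^+ p.2)%R])%E]].

Definition vertical_line (j : nat) : set (nat * nat) :=
  [set p | p.1 = j /\ (0 < p.2)%N].

Definition horizontal_line (k : nat) : set (nat * nat) :=
  [set p | (0 < p.1)%N /\ p.2 = k].

(* Main.v *)
Require Import Defs.
From HB Require Import structures.
From mathcomp Require Import all_boot all_order all_algebra.
From mathcomp Require Import all_classical all_reals all_analysis.
From mathcomp Require Import measurable_realfun ring lra.
Import Order.TTheory GRing.Theory Num.Theory.
Import numFieldNormedType.Exports.
Local Open Scope classical_set_scope.
Local Open Scope ring_scope.

(** Write [x_0, x_1, x_2] for the values [a, b, c].  Both marginals being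
    uniform, the joint law is determined by the deviations
    [D i l = P (X = x_i, Y = x_l) - 1/9] from independence, a 3 x 3 matrix all
    of whose rows and columns sum to zero, and [(j, k)] is an uncorrelatedness
    point exactly when [\sum_(i, l) D i l * x_i ^ j * x_l ^ k = 0]
    ([uncorrelatedP]).  So the question is one about a bilinear form evaluated
    at the power vectors [(x_0 ^ j, x_1 ^ j, x_2 ^ j)], taken modulo constant
    vectors.  In this two-dimensional quotient, the classes of the power
    vectors with two distinct positive exponents are linearly independent: this
    is the non-vanishing of the generalized Vandermonde determinant with
    exponents [0, i, j] ([gvandermonde_eq0]).

    Two points on one vertical line give two independent vectors killed by the
    linear form obtained by fixing [j], which hence vanishes; this is Cramer's
    rule ([gvandermonde_cramer], [uncorrelated_vertical]).  The horizontal case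
    follows by exchanging [X] and [Y].

    If [j1 <> j2] and [k1 <> k2], then, writing [W] for the determinant, the
    bilinear forms that vanish at both points are spanned by
    [W j2 j * W k1 k] and [W j1 j * W k2 k].  Apart from the two given points,
    no [(j, k)] annuls both of them, so that each other [(j, k)] is annulled by
    the combination [W j2 j * W k1 k + t * (W j1 j * W k2 k)] for at most one
    [t].
    There are countably many [(j, k)] and uncountably many [t], so some [t]
    avoids all these values.  The matrix of the resulting form, scaled down
    until [1/9 + D] is nonnegative, is realized by a law carried by the nine
    points of the grid ([exists_unif3_pair]). *)

(** * A generalized 3 x 3 Vandermonde determinant *)

Section GeneralizedVandermonde.
Context {R : realFieldType}.
Implicit Types (a b c : R) (u : nat -> R) (i j k m l : nat).

Definition point3 a b c l : R := nth 0 [:: a; b; c] l.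

(** The determinant with rows [(1, 1, 1)], [(a ^ i, b ^ i, c ^ i)] and
    [(a ^ j, b ^ j, c ^ j)], after subtraction of the first column. *)
Definition gvandermonde a b c i j : R :=
  (b ^+ i - a ^+ i) * (c ^+ j - a ^+ j) - (b ^+ j - a ^+ j) * (c ^+ i - a ^+ i).

(** The cofactors along the last row of the matrix of [gvandermonde a b c i j],
    which do not depend on [j]. *)
Definition gcofactor a b c i l : R :=
  nth 0 [:: c ^+ i - b ^+ i; a ^+ i - c ^+ i; b ^+ i - a ^+ i] l.

Lemma sum_gcofactor a b c i : \sum_(l < 3) gcofactor a b c i l = 0.
Proof. rewrite !big_ord_recr big_ord0 /gcofactor /=; ring. Qed.

Lemma gvandermonde_expand a b c i j :
  \sum_(l < 3) gcofactor a b c i l * point3 a b c l ^+ j =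
  gvandermonde a b c i j.
Proof.
rewrite !big_ord_recr big_ord0 /gcofactor /point3 /gvandermonde /=; ring.
Qed.

(** On coefficient vectors of sum zero, the values of [f] at two exponents
    determine all the others, by Cramer's rule in dimension two. *)
Lemma gvandermonde_cramer a b c u k1 k2 m : \sum_(l < 3) u l = 0 ->
  let f k := \sum_(l < 3) u l * point3 a b c l ^+ k in
  f m * gvandermonde a b c k1 k2 =
  f k1 * gvandermonde a b c m k2 + f k2 * gvandermonde a b c k1 m.
Proof.
rewrite /= !big_ord_recr !big_ord0 /point3 /gvandermonde /= add0r => h.
have -> : u 0%N = - u 1%N - u 2%N by lra.
ring.
Qed.

Lemma gvandermonde_antisym a b c i j :
  gvandermonde a b c j i = - gvandermonde a b c i j.
Proof. rewrite /gvandermonde; ring. Qed.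

Lemma gvandermonde_diag a b c i : gvandermonde a b c i i = 0.
Proof. rewrite /gvandermonde; ring. Qed.

(** The recurrence makes the positivity for consecutive exponents evident:
    when [0 < a < b < c], every term that it adds is positive. *)
Lemma gvandermondeSS a b c k : gvandermonde a b c k.+1 k.+2 =
  a * c * gvandermonde a b c k k.+1 +
  (c - b) * (b - a) * b ^+ k * (c ^+ k.+1 - a ^+ k.+1).
Proof. rewrite /gvandermonde !exprS; ring. Qed.

(** The expansion of the vanishing 3 x 3 determinant with columns
    [(b ^ n - a ^ n, b ^ n - a ^ n, c ^ n - a ^ n)], for [n] in [i, j, k], along
    one of its two equal rows.  It propagates positivity from consecutive
    exponents to arbitrary ones. *)
Lemma gvandermonde_plucker a b c i j k :
  (b ^+ j - a ^+ j) * gvandermonde a b c i k =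
  (b ^+ i - a ^+ i) * gvandermonde a b c j k +
  (b ^+ k - a ^+ k) * gvandermonde a b c i j.
Proof. rewrite /gvandermonde; ring. Qed.

Lemma exprB_gt0 a b k : 0 < a -> a < b -> (0 < k)%N -> 0 < b ^+ k - a ^+ k.
Proof.
by move=> ha hab k0; rewrite subr_gt0 ltrXn2r ?gtn_eqF// ltW// (lt_trans ha).
Qed.

Lemma gvandermondeS_gt0 a b c k : 0 < a -> a < b -> b < c -> (0 < k)%N ->
  0 < gvandermonde a b c k k.+1.
Proof.
move=> ha hab hbc; have hac := lt_trans hab hbc.
have hb := lt_trans ha hab; have hc := lt_trans hb hbc.
have step m : 0 < (c - b) * (b - a) * b ^+ m * (c ^+ m.+1 - a ^+ m.+1).
  by rewrite mulr_gt0 ?exprB_gt0// !mulr_gt0 ?subr_gt0 ?exprn_gt0.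
case: k => // k _; elim: k => [|k IHk]; rewrite gvandermondeSS.
  have -> : gvandermonde a b c 0 1 = 0 by rewrite /gvandermonde; ring.
  by rewrite mulr0 add0r step.
by apply: addr_gt0 (step _); rewrite !mulr_gt0.
Qed.

Lemma gvandermonde_gt0 a b c i j : 0 < a -> a < b -> b < c -> (0 < i < j)%N ->
  0 < gvandermonde a b c i j.
Proof.
move=> ha hab hbc /andP[i0]; elim: j => // j IHj.
rewrite ltnS leq_eqVlt => /orP[/eqP<-|ij]; first exact: gvandermondeS_gt0.
have j0 : (0 < j)%N by apply: leq_ltn_trans ij.
rewrite -(pmulr_rgt0 _ (exprB_gt0 _ _ _ ha hab j0)).
rewrite (gvandermonde_plucker _ _ _ i j).
by rewrite addr_gt0 ?mulr_gt0 ?exprB_gt0 ?gvandermondeS_gt0 ?IHj.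
Qed.

Lemma gvandermonde_eq0 a b c i j : 0 < a -> a < b -> b < c ->
  (0 < i)%N -> (0 < j)%N -> (gvandermonde a b c i j == 0) = (i == j).
Proof.
move=> ha hab hbc i0 j0; case: (ltngtP i j) => [ij|ji|->].
- by rewrite gt_eqF// gvandermonde_gt0// i0.
- by rewrite gvandermonde_antisym oppr_eq0 gt_eqF// gvandermonde_gt0// j0.
- by rewrite gvandermonde_diag eqxx.
Qed.

End GeneralizedVandermonde.

(** * Parameters outside a countable set *)

(** A countable set is Lebesgue-null, whereas [[0, 1]] is not. *)
Lemma avoid_countable_family (R : realType) (I : countType) (f : I -> R) :
  exists t, forall i, t != f i.
Proof.
apply: contrapT => H.
have rf : `[0%R, 1%R] `<=` range f.
  move=> t _; apply: contrapT => nt; apply: H; exists t => i.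
  by apply/eqP => ti; apply: nt; exists i.
have : countable (`[0%R, 1%R]%classic : set R).
  apply: (sub_countable (subset_card_le rf)).
  exact: sub_countable (card_image_le _ _) (countableP _).
move=> /countable_lebesgue_measure0.
rewrite lebesgue_measure_itv/= lte_fin ltr01 => /eqP.
by rewrite -EFinB subr0 onee_eq0.
Qed.

(** * Integration over a finite almost sure partition *)

Section FinitePartition.
Context d (T : measurableType d) (R : realType) (P : probability T R).
Context (I : finType) (A : I -> set T).
Context (mA : forall i, measurable (A i)) (tA : trivIset setT A)
  (A1 : (\sum_(i : I) P (A i) = 1)%E).

Let U := \big[setU/set0]_(i <- index_enum I) A i.

Let mU : measurable U. Proof. exact: bigsetU_measurable. Qed.

Let integral_partition (f : T -> R) : measurable_fun U f ->
  (\int[P]_(x in U) (f x)%:E = \sum_(i : I) \int[P]_(x in A i) (f x)%:E)%E.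
Proof.
move=> mf; apply: integral_bigsetU_EFin => //.
- exact: index_enum_uniq.
- exact: sub_trivIset tA.
- exact/measurable_EFinP.
Qed.

Let probability_partition : P U = 1%E.
Proof.
rewrite -A1 -[P U]mul1e -integral_cst//.
rewrite (integral_partition (cst 1))//.
by apply: eq_bigr => i _; rewrite (@integral_cst _ _ _ _ (A i) _ 1%E)// mul1e.
Qed.

Lemma integral_ae_partition (f : T -> R) : measurable_fun setT f ->
  (\int[P]_x (f x)%:E = \sum_(i : I) \int[P]_(x in A i) (f x)%:E)%E.
Proof.
move=> mf; rewrite -integral_partition; last exact: measurable_funTS.
rewrite [RHS]integral_mkcond; apply: ae_eq_integral => //.
- exact/measurable_EFinP.
- apply/(measurable_restrictT _ mU)/measurable_EFinP; exact: measurable_funTS.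
- exists (~` U); split; first exact: measurableC.
    by have := probability_setC P mU; rewrite probability_partition subee.
  move=> x /= nfx Ux; apply: nfx => _.
  by rewrite patchE mem_set.
Qed.

Lemma probability_total (E : set T) : measurable E ->
  P E = (\sum_(i : I) P (E `&` A i))%E.
Proof.
move=> mE; have := @integral_ae_partition (\1_E).
rewrite integral_indic// setIT => ->//.
by apply: eq_bigr => i _; rewrite integral_indic.
Qed.

Lemma expectation_total (f : T -> R) (y : I -> R) : measurable_fun setT f ->
  (forall i x, A i x -> f x = y i) ->
  ('E_P[f] = \sum_(i : I) (y i)%:E * P (A i))%E.
Proof.
move=> mf fy; rewrite unlock integral_ae_partition//.
apply: eq_bigr => i _; rewrite -integral_cst//.
by apply: eq_integral => x /set_mem /fy ->.
Qed.

End FinitePartition.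

(** * Laws carried by a finite grid *)

Lemma exists_grid_distribution (R : realType) (n : nat) (x : nat -> R)
    (w : nat -> nat -> R) :
  (forall i l : 'I_n, 0 <= w i l) -> \sum_(i < n) \sum_(l < n) w i l = 1 ->
  exists P : probability (R * R)%type R, forall A,
    P A = (\sum_(i < n) \sum_(l < n) w i l * \1_A (x i, x l))%:E.
Proof.
move=> w0 w1.
(* The absolute value is the identity on the grid; it only provides
   nonnegative weights at indices beyond [n], as [msum] and [mscale] require. *)
pose mu : {measure set (R * R) -> \bar R} := msum (fun i => msum (fun l =>
  mscale (NngNum (normr_ge0 (w i l))) (dirac (x i, x l))) n) n.
have muE A : mu A = (\sum_(i < n) \sum_(l < n) w i l * \1_A (x i, x l))%:E.
  rewrite /mu /= /msum -sumEFin; apply: eq_bigr => i _.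
  rewrite /= /msum -sumEFin; apply: eq_bigr => l _.
  by rewrite /= /mscale /= ger0_norm.
have muT : mu setT = 1%E.
  rewrite muE -w1; congr EFin; apply: eq_bigr => i _; apply: eq_bigr => l _.
  by rewrite indicT mulr1.
(* Since [mu] has mass 1, normalizing it is the identity, whatever the default
   law supplied for degenerate measures. *)
exists (mnormalize mu (dirac ((0, 0) : (R * R)%type))) => A.
by rewrite /= /mnormalize muT onee_eq0 /= invr1 mule1 muE.
Qed.

Lemma exists_random_variable d (T : measurableType d) (R : realType)
    (P : probability T R) (f : T -> R) : measurable_fun setT f ->
  exists X : {RV P >-> R}, (X : T -> R) = f.
Proof. by move=> mf; exists (mfun_Sub (mem_set mf)); rewrite mfun_valP. Qed.

(** * Pairs of uniform variables on three points *)

Section UniformPair.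
Context d (T : measurableType d) (R : realType) (P : probability T R).
Context (a b c : R) (hab : a < b) (hbc : b < c).
Local Notation x := (point3 a b c).
Implicit Types X Y : {RV P >-> R}.

Definition joint_mass X Y (i l : nat) : R :=
  fine (P (X @^-1` [set x i] `&` Y @^-1` [set x l])).

Lemma point3_inj (i l : 'I_3) : x i = x l -> i = l.
Proof.
have hac := lt_trans hab hbc; move=> h; apply/val_inj; move: h.
by case: i l => [[|[|[|//]]] ?] [[|[|[|//]]] ?] //=; rewrite /point3 /= => h;
  move: hab hbc hac; rewrite h ltxx.
Qed.

Lemma measurable_level X (y : R) : measurable (X @^-1` [set y]).
Proof. exact: measurable_funPTI. Qed.

Lemma trivIset_level X :
  trivIset setT (fun i : 'I_3 => X @^-1` [set x i]).
Proof. by move=> i l _ _ [t [/= -> /point3_inj]]. Qed.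

Lemma unif3E X (i : 'I_3) : unif3 a b c X -> P (X @^-1` [set x i]) = (3^-1)%:E.
Proof. by case: i => [[|[|[|//]]] ?] []. Qed.

Lemma sum_unif3 X : unif3 a b c X ->
  (\sum_(i < 3) P (X @^-1` [set x i]) = 1)%E.
Proof.
move=> uX; under eq_bigr do rewrite unif3E//.
rewrite sumEFin big_const_ord /=; congr EFin; lra.
Qed.

Lemma joint_massE X Y i l :
  (P (X @^-1` [set x i] `&` Y @^-1` [set x l]) = (joint_mass X Y i l)%:E)%E.
Proof.
rewrite fineK// fin_num_measure//; apply: measurableI; exact: measurable_level.
Qed.

Lemma sum_joint_mass X Y (i : 'I_3) : unif3 a b c X -> unif3 a b c Y ->
  \sum_(l < 3) joint_mass X Y i l = 3^-1.
Proof.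
move=> uX uY; apply: EFin_inj; rewrite -(unif3E _ i uX) -sumEFin.
have mX := measurable_level X (x i).
rewrite (probability_total _ _ _ _ _ _ _ (trivIset_level Y) (sum_unif3 _ uY))//.
by apply: eq_bigr => l _; rewrite joint_massE.
Qed.

Lemma unif3_moment X Y j k : unif3 a b c X -> unif3 a b c Y ->
  ('E_P[fun t => (X t ^+ j * Y t ^+ k)%R] =
   (\sum_(i < 3) \sum_(l < 3) joint_mass X Y i l * (x i ^+ j * x l ^+ k))%:E)%E.
Proof.
move=> uX uY.
pose A (p : 'I_3 * 'I_3) := X @^-1` [set x p.1] `&` Y @^-1` [set x p.2].
have mA p : measurable (A p) by apply: measurableI; exact: measurable_level.
have tA : trivIset setT A.
  move=> [p1 p2] [q1 q2] _ _ [t [[/= Xp Yp] [/= Xq Yq]]].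
  by congr pair; apply: point3_inj; rewrite -?Xp -?Yp.
have A1 : (\sum_p P (A p) = 1)%E.
  rewrite -(sum_unif3 _ uX) -(pair_bigA _ (fun i l => P (A (i, l)))) /=.
  apply: eq_bigr => i _; rewrite unif3E//.
  rewrite -(sum_joint_mass _ _ i uX uY) -sumEFin.
  by apply: eq_bigr => l _; rewrite -joint_massE.
rewrite (expectation_total _ _ _ _ _ _ mA tA A1 _
  (fun p => x p.1 ^+ j * x p.2 ^+ k)).
- rewrite pair_big -sumEFin; apply: eq_bigr => p _.
  by rewrite /A joint_massE -EFinM mulrC.
- by apply: measurable_funM; apply: measurable_funX; exact: measurable_funPT.
- by move=> p t [/= -> ->].
Qed.

Lemma unif3_moment1 X j : unif3 a b c X ->
  ('E_P[fun t => (X t ^+ j)%R] = (3^-1 * \sum_(i < 3) x i ^+ j)%:E)%E.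
Proof.
(* The joint law of [X] with itself and the exponent 0 give the marginal. *)
move=> uX; have := unif3_moment _ _ j 0 uX uX.
under eq_fun do rewrite expr0 mulr1.
move=> ->; congr EFin; rewrite mulr_sumr; apply: eq_bigr => i _.
under eq_bigr do rewrite expr0 mulr1.
by rewrite -mulr_suml sum_joint_mass.
Qed.

(** The constant [1/9] is the joint mass under independence: the marginals
    being fixed, a covariance of powers is linear in the deviation from it. *)
Lemma uncorrelatedP X Y j k : unif3 a b c X -> unif3 a b c Y ->
  (0 < j)%N -> (0 < k)%N ->
  uncorrelatedness_set X Y (j, k) <->
  \sum_(i < 3) \sum_(l < 3)
       (joint_mass X Y i l - 9^-1) * (x i ^+ j * x l ^+ k) = 0.
Proof.
move=> uX uY j0 k0.
have -> : \sum_(i < 3) \sum_(l < 3)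
      (joint_mass X Y i l - 9^-1) * (x i ^+ j * x l ^+ k) =
    (\sum_(i < 3) \sum_(l < 3) joint_mass X Y i l * (x i ^+ j * x l ^+ k)) -
    (3^-1 * \sum_(i < 3) x i ^+ j) * (3^-1 * \sum_(i < 3) x i ^+ k).
  by rewrite !big_ord_recr !big_ord0 /=; field; rewrite ?pnatr_eq0.
split=> [[_ _] /=|/subr0_eq h].
  by rewrite unif3_moment// !unif3_moment1// -EFinM => -[->]; rewrite subrr.
by split=> //=; rewrite unif3_moment// !unif3_moment1// -EFinM h.
Qed.

Lemma uncorrelatedC X Y j k :
  uncorrelatedness_set X Y (j, k) -> uncorrelatedness_set Y X (k, j).
Proof.
case=> /= j0 k0 h; split=> //=.
by under eq_fun do rewrite mulrC; rewrite h muleC.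
Qed.

(** For fixed [j], the deviations weighted by [x i ^+ j] form a vector of sum
    zero, and [gvandermonde_cramer] applies to it. *)
Lemma uncorrelated_vertical X Y j k1 k2 m : 0 < a ->
  unif3 a b c X -> unif3 a b c Y -> k1 != k2 -> (0 < m)%N ->
  uncorrelatedness_set X Y (j, k1) -> uncorrelatedness_set X Y (j, k2) ->
  uncorrelatedness_set X Y (j, m).
Proof.
move=> ha uX uY k12 m0 U1 U2.
have [[/= j0 k10 _] [/= _ k20 _]] := (U1, U2).
pose u (l : nat) := \sum_(i < 3) (joint_mass X Y i l - 9^-1) * x i ^+ j.
have u0 : \sum_(l < 3) u l = 0.
  rewrite exchange_big /= big1// => i _.
  rewrite -mulr_suml big_split /= sum_joint_mass// big_const_ord /=.
  rewrite [X in X * _](_ : _ = 0) ?mul0r//; lra.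
have uE k : (0 < k)%N -> uncorrelatedness_set X Y (j, k) <->
    \sum_(l < 3) u l * x l ^+ k = 0.
  move=> k0; rewrite (iffRL (propeqP _ _) (uncorrelatedP _ _ _ _ uX uY j0 k0)).
  rewrite exchange_big; under eq_bigr => l _.
    under eq_bigr do rewrite mulrA.
    rewrite -mulr_suml; over.
  by [].
move: U1 U2 => /(uE _ k10) U1 /(uE _ k20) U2; apply/(uE _ m0).
have /eqP := gvandermonde_cramer a b c u k1 k2 m u0.
rewrite /= U1 U2 !mul0r addr0 mulf_eq0 gvandermonde_eq0// (negbTE k12) orbF.
by move=> /eqP.
Qed.

End UniformPair.

(** Every matrix with zero row and column sums is, up to a nonzero factor, the
    deviation from independence of a pair with uniform marginals. *)
Lemma exists_unif3_pair (R : realType) (a b c : R) (D : nat -> nat -> R) :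
  a < b -> b < c ->
  (forall i : 'I_3, \sum_(l < 3) D i l = 0) ->
  (forall l : 'I_3, \sum_(i < 3) D i l = 0) ->
  exists (e : R) (P : probability (R * R)%type R) (X Y : {RV P >-> R}),
    [/\ e != 0, unif3 a b c X, unif3 a b c Y &
        forall i l : 'I_3,
          joint_mass _ _ R P a b c X Y i l = 9^-1 + e * D i l].
Proof.
move=> hab hbc Dr Dc.
(* A bound on the entries of [D]; the [1] makes it invertible when [D = 0]. *)
pose M := 1 + \sum_(p : 'I_3 * 'I_3) `|D p.1 p.2|.
have M0 : 0 < M by rewrite ltr_pwDl// sumr_ge0.
have DM (i l : 'I_3) : `|D i l| <= M.
  rewrite /M (bigD1 (i, l))//= addrCA lerDl addr_ge0// sumr_ge0//.
pose e := (9 * M)^-1.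
have e0 : 0 < e by rewrite invr_gt0 mulr_gt0.
pose w i l := 9^-1 + e * D i l.
have w0 (i l : 'I_3) : 0 <= w i l.
  suff : `|e * D i l| <= 9^-1 by rewrite /w ler_norml; lra.
  rewrite normrM gtr0_norm// /e invfM -mulrA ler_piMr//.
  by rewrite mulrC ler_pdivrMr// mul1r.
have rowE (i : 'I_3) : \sum_(l < 3) w i l = 3^-1 :> R.
  by rewrite /w big_split /= -mulr_sumr Dr big_const_ord /=; lra.
have colE (l : 'I_3) : \sum_(i < 3) w i l = 3^-1 :> R.
  by rewrite /w big_split /= -mulr_sumr Dc big_const_ord /=; lra.
have [|P PE] := exists_grid_distribution R 3 (point3 a b c) w w0.
  by under eq_bigr do rewrite rowE; rewrite big_const_ord /=; lra.
have [X XE] := exists_random_variable _ _ _ P fst measurable_fst.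
have [Y YE] := exists_random_variable _ _ _ P snd measurable_snd.
have pE (l i : 'I_3) : (point3 a b c l == point3 a b c i) = (l == i).
  apply/eqP/eqP => [/(point3_inj _ _ _ _ hab hbc)//|->//].
have PX (i : 'I_3) : P (X @^-1` [set point3 a b c i]) = (3^-1)%:E.
  rewrite PE XE (bigD1 i)//= [X in (_ + X)%:E]big1 => [|k ki].
    rewrite addr0 -(rowE i); congr EFin; apply: eq_bigr => l _.
    by rewrite indicE mem_set//= mulr1.
  apply: big1 => l _; rewrite indicE memNset ?mulr0//=.
  by apply/eqP; rewrite pE.
have PY (i : 'I_3) : P (Y @^-1` [set point3 a b c i]) = (3^-1)%:E.
  rewrite PE YE exchange_big (bigD1 i)//= [X in (_ + X)%:E]big1 => [|k ki].
    rewrite addr0 -(colE i); congr EFin; apply: eq_bigr => l _.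
    by rewrite indicE mem_set//= mulr1.
  apply: big1 => l _; rewrite indicE memNset ?mulr0//=.
  by apply/eqP; rewrite pE.
exists e, P, X, Y; split; first by rewrite gt_eqF.
- by split; [exact: (PX ord0)|exact: (PX (@Ordinal 3 1 isT))|
    exact: (PX (@Ordinal 3 2 isT))].
- by split; [exact: (PY ord0)|exact: (PY (@Ordinal 3 1 isT))|
    exact: (PY (@Ordinal 3 2 isT))].
move=> i l; rewrite /joint_mass PE XE YE /= (bigD1 i)//=.
rewrite [X in _ + X]big1; last first.
  move=> k ki; apply: big1 => m _; rewrite indicE memNset ?mulr0//=.
  by move=> [/eqP]; rewrite pE (negbTE ki).
rewrite addr0 (bigD1 l)//= big1 ?addr0 => [|k kl].
  by rewrite indicE mem_set//= mulr1.
rewrite indicE memNset ?mulr0//=.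
by move=> [_ /eqP]; rewrite pE (negbTE kl).
Qed.

(** * Prescribing two uncorrelatedness points *)

Lemma exists_unif3_uncorrelated_pair (R : realType) (a b c : R)
    (j1 k1 j2 k2 : nat) : 0 < a -> a < b -> b < c ->
  (0 < j1)%N -> (0 < k1)%N -> (0 < j2)%N -> (0 < k2)%N ->
  j1 != j2 -> k1 != k2 ->
  exists (P : probability (R * R)%type R) (X Y : {RV P >-> R}),
    [/\ unif3 a b c X, unif3 a b c Y &
        uncorrelatedness_set X Y = [set (j1, k1); (j2, k2)]].
Proof.
move=> ha hab hbc j10 k10 j20 k20 j12 k12.
pose W := gvandermonde a b c; pose L := gcofactor a b c.
(* The value of the parameter to be avoided because of the exponents [p]; if
   the denominator is zero, then the covariance does not depend on [t]. *)
have [t tP] := avoid_countable_family R (nat * nat)%type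
  (fun p => - (W j2 p.1 * W k1 p.2) / (W j1 p.1 * W k2 p.2)).
(* The matrix of the form [W j2 j * W k1 k + t * (W j1 j * W k2 k)], read off
   from the cofactor expansions of the four determinants. *)
have [||e [P [X [Y [e0 uX uY XYE]]]]] := exists_unif3_pair R a b c
    (fun i l => L j2 i * L k1 l + t * (L j1 i * L k2 l)) hab hbc.
- by move=> i; rewrite big_split /= -!mulr_sumr !sum_gcofactor !mulr0 addr0.
- by move=> l; rewrite big_split /= -mulr_sumr -!mulr_suml !sum_gcofactor
    !mul0r mulr0 addr0.
have covE j k : (0 < j)%N -> (0 < k)%N -> uncorrelatedness_set X Y (j, k) <->
    W j2 j * W k1 k + t * (W j1 j * W k2 k) = 0.
  move=> j0 k0.
  have := uncorrelatedP _ _ R P a b c hab hbc X Y j k uX uY j0 k0.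
  move=> /propext ->.
  under eq_bigr => i _ do under eq_bigr => l _ do
    rewrite XYE addrAC subrr add0r.
  set s := (X in X = 0 <-> _).
  have -> : s = e * (W j2 j * W k1 k + t * (W j1 j * W k2 k)).
    rewrite /s /W /L -!gvandermonde_expand !big_ord_recr !big_ord0 /=; ring.
  split=> [/eqP|->]; last by rewrite mulr0.
  by rewrite mulf_eq0 (negbTE e0) => /eqP.
exists P, X, Y; split=> //; apply/seteqP; split=> [[j k]|_ [->|->]].
- move=> U; have [/= j0 k0 _] := U; move/(covE _ _ j0 k0): U => /eqP U.
  have W0 := gvandermonde_eq0 a b c _ _ ha hab hbc.
  have /eqP CD : W j1 j * W k2 k == 0.
    apply: contraT => CD; have /= := tP (j, k).
    by rewrite -(inj_eq (mulIf CD)) mulfVK// -subr_eq0 opprK addrC U.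
  move: U; rewrite CD mulr0 addr0 => /eqP AB; move: AB CD => /eqP + /eqP.
  (* The two mixed cases would equate [j1] with [j2], or [k1] with [k2]. *)
  rewrite !mulf_eq0 !W0// => /orP[] /eqP eAB /orP[] /eqP eCD.
  + by move: j12; rewrite eAB eCD eqxx.
  + by right; rewrite eAB eCD.
  + by left; rewrite eAB eCD.
  + by move: k12; rewrite eAB eCD eqxx.
- apply/(covE _ _ j10 k10).
  by rewrite /W !gvandermonde_diag mulr0 mul0r mulr0 addr0.
- apply/(covE _ _ j20 k20).
  by rewrite /W !gvandermonde_diag mul0r mulr0 mulr0 addr0.
Qed.

Theorem theorem2p4 (R : realType) (a b c : R) (j1 k1 j2 k2 : nat)
    (ha : 0 < a) (hab : a < b) (hbc : b < c)
    (hj1 : (0 < j1)%N) (hk1 : (0 < k1)%N)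
    (hj2 : (0 < j2)%N) (hk2 : (0 < k2)%N)
    (hP : (j1, k1) <> (j2, k2)) :
  [/\ (forall (d : measure_display) (T : measurableType d)
          (P : probability T R) (X Y : {RV P >-> R}),
        unif3 a b c X -> unif3 a b c Y ->
        [set (j1, k1); (j2, k2)] `<=` uncorrelatedness_set X Y ->
        forall j : nat, j1 = j -> j2 = j ->
        vertical_line j `<=` uncorrelatedness_set X Y),
      (forall (d : measure_display) (T : measurableType d)
          (P : probability T R) (X Y : {RV P >-> R}),
        unif3 a b c X -> unif3 a b c Y ->
        [set (j1, k1); (j2, k2)] `<=` uncorrelatedness_set X Y ->
        forall k : nat, k1 = k -> k2 = k ->
        horizontal_line k `<=` uncorrelatedness_set X Y)
    & (j1 <> j2 -> k1 <> k2 ->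
        exists (d : measure_display) (T : measurableType d)
          (P : probability T R) (X Y : {RV P >-> R}),
        [/\ unif3 a b c X, unif3 a b c Y &
            uncorrelatedness_set X Y = [set (j1, k1); (j2, k2)]])].
Proof.
split.
- move=> d T P X Y uX uY U j jE1 jE2 [_ m] [/= -> m0].
  move: jE1 jE2 hP U => -> -> hP U.
  apply: (uncorrelated_vertical _ _ _ P a b c hab hbc X Y j k1 k2 m) => //.
  + by apply/eqP => k12; apply: hP; rewrite k12.
  + by apply: U; left.
  + by apply: U; right.
- move=> d T P X Y uX uY U k kE1 kE2 [m _] [/= m0 ->].
  move: kE1 kE2 hP U => -> -> hP U.
  apply: uncorrelatedC.
  apply: (uncorrelated_vertical _ _ _ P a b c hab hbc Y X k j1 j2 m) => //.
  + by apply/eqP => j12; apply: hP; rewrite j12.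
  + by apply: uncorrelatedC; apply: U; left.
  + by apply: uncorrelatedC; apply: U; right.
- move=> /eqP j12 /eqP k12.
  have [P [X [Y XY]]] := exists_unif3_uncorrelated_pair R a b c j1 k1 j2 k2
    ha hab hbc hj1 hk1 hj2 hk2 j12 k12.
  by exists _, (R * R)%type, P, X, Y.
Qed.
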